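(* Let $G$ be a labeled graph with vertex set $[n]$. Then $G$ is $12$-representable by a $132$-avoiding word if and only if neither of the following occurs: (a) vertices $x<y<z$ with $yz\in E(G)$ and $xz\notin E(G)$; (b) vertices $x<y<z<w$ with $xw\in E(G)$ and $xz, yw\notin E(G)$.
   Context: All graphs are finite, simple and undirected. Let $[n]=\{1,\ldots,n\}$. For a word $w$ over positive integers, $\mathrm{red}(w)$ is the word obtained from $w$ by replacing each occurrence of the $i$th smallest letter with $i$. For a word (pattern) $p=p_1\cdots p_k$ with $\mathrm{red}(p)=p$, a word $w=w_1\cdots w_\ell$ contains $p$ if there are indices $i_1<\cdots<i_k$ with $\mathrm{red}(w_{i_1}\cdots w_{i_k})=p$; otherwise $w$ avoids $p$ (is $p$-avoiding). A labeled graph with vertex set $[n]$ is $12$-represented by a word $w$ over $[n]$ containing at least one copy of each letter of $[n]$ if for all $i<j$ in $[n]$: $i$ and $j$ are adjacent if and only if every occurrence of $j$ precedes every occurrence of $i$ in $w$. A labeled graph is $12$-representable by a $p$-avoiding word if it is $12$-represented, with its given labels, by some $p$-avoiding word. *)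

(* Defs.v *)
From mathcomp Require Import all_boot.

Set Implicit Arguments.
Unset Strict Implicit.
Unset Printing Implicit Defensive.

(* Letters are replaced with their ranks, which are counted from 1. *)
Definition red (w : seq nat) : seq nat :=
  [seq (index a (sort leq (undup w))).+1 | a <- w].

Definition contains_pattern (p w : seq nat) : Prop :=
  exists2 s : seq nat, subseq s w & red s = p.

Definition avoids (p w : seq nat) : Prop := ~ contains_pattern p w.

(* [n] = {1, ..., n} is encoded as 'I_n, with i : 'I_n standing for the label
   i.+1; [word_of] recovers the word over positive integers. *)
Definition word_of (n : nat) (w : seq 'I_n) : seq nat :=
  [seq (val i).+1 | i <- w].

Definition all_precede (T : Type) (w : seq T) (x y : T) : Prop :=
  forall a b : nat, onth w a = Some x -> onth w b = Some y -> a < b.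

Definition represents12 (n : nat) (w : seq 'I_n) (e : rel 'I_n) : Prop :=
  (forall i : 'I_n, i \in w) /\
  (forall i j : 'I_n, i < j -> (e i j <-> all_precede w j i)).

Definition representable12_avoiding (n : nat) (p : seq nat) (e : rel 'I_n) :
    Prop :=
  exists2 w : seq 'I_n, avoids p (word_of w) & represents12 w e.

(* Main.v *)
Require Import Defs.
From mathcomp Require Import all_boot zify.

(** Read edges downwards. The absence of (a) says that the neighbours of [j]
    below [j] form an initial segment, so that a single number [D j] encodes
    them (vertices are numbered from 0): for [i < j], the pair [i j] is an edge
    exactly when [i < D j]. The absence of (b) then says that [D w <= D z] or [z
    <= D w] whenever [z < w]. On the side of words, [i < j] are not adjacent
    exactly when [[:: i; j]] is a subsequence, and 132 is contained when some
    [[:: x; z; y]] with [x < y < z] is one.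

    Necessity is immediate: in case (a) the letters [x], [z], [y] occur in this
    order, and in case (b) the letters [y], [w], [x], [z] do, so that [y], [w],
    [z] is a copy of 132.

    For sufficiency, a word is built recursively on intervals of letters
    ([threshold_word]).  Let [m] be the largest letter and [d] its threshold.
    Suppose that a 132-avoiding word has all letters from [d] to [m - 1] before
    its last [m] and the letters below [d] only after it.  Then it is
    [A ++ m :: B], where the letters of [A] are at least [d] and, as soon as [d]
    occurs before [m], those of [B] are at most [d].  Conversely, taking for [A]
    and [B] words for the intervals from [d] to [m - 1] and up to [d] never
    creates a 132.  The only pairs below [m] that neither [A] nor [B] takes care
    of are [x < d < y < m]; there [y] precedes [x], as it should, since the
    condition on [D] forces [D y >= D m > x]. *)

(** * Subsequences *)

Lemma subseq_cat_split (T : eqType) (s u v : seq T) :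
  subseq s (u ++ v) ->
  exists s1 s2, [/\ s = s1 ++ s2, subseq s1 u & subseq s2 v].
Proof.
case/subseqP=> m; rewrite size_cat => sz_m ->.
exists (mask (take (size u) m) u), (mask (drop (size u) m) v); split.
- by rewrite -mask_cat ?cat_take_drop // size_takel // sz_m leq_addr.
- exact: mask_subseq.
- exact: mask_subseq.
Qed.

Lemma subseq2_cat {T : eqType} (x y : T) (u v : seq T) :
  subseq [:: x; y] (u ++ v) =
  [|| subseq [:: x; y] u, (x \in u) && (y \in v) | subseq [:: x; y] v].
Proof.
apply/idP/or3P.
- case/subseq_cat_split=> [[|a [|b [|c s1]]]] [s2 [] //=].
  + by move=> <- _ ?; apply: Or33.
  + by case=> -> <-; rewrite !sub1seq => -> ->; apply: Or32.
  + by case=> -> -> _ ? _; apply: Or31.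
- case=> [sub | /andP[xu yv] | sub].
  + exact: subseq_trans sub (prefix_subseq _ _).
  + by rewrite (@cat_subseq _ [:: x] [:: y]) ?sub1seq.
  + exact: subseq_trans sub (suffix_subseq _ _).
Qed.

Lemma subseq2_onth {T : eqType} (x y : T) (w : seq T) :
  subseq [:: x; y] w <->
  exists a b, [/\ a < b, onth w a = Some x & onth w b = Some y].
Proof.
have onth_mem (s : seq T) z : z \in s <-> exists a, onth s a = Some z.
  elim: s => [|c s IHs]; first by split=> // -[[]].
  rewrite inE; split=> [/predU1P[-> | /IHs[a ?]] | [[[->] | a /= sa]]].
  - by exists 0.
  - by exists a.+1.
  - by rewrite eqxx.
  - by rewrite (IHs.2 _) ?orbT //; exists a.
elim: w => [|c w IHw]; first by split=> // -[[|a] [b []]].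
split.
- rewrite /=; case: eqP => [-> | _].
    by rewrite sub1seq => /onth_mem[b ?]; exists 0, b.+1.
  by case/IHw=> a [b [? ? ?]]; exists a.+1, b.+1.
- case=> [[|a]] [[|b] [//=]] ltab.
    by case=> -> wb; rewrite eqxx sub1seq; apply/onth_mem; exists b.
  move=> wa wb; case: eqP => _; last by apply/IHw; exists a, b.
  by rewrite sub1seq; apply/onth_mem; exists b.
Qed.

Lemma all_precedeE (T : eqType) (w : seq T) (x y : T) :
  x != y -> all_precede w y x <-> ~~ subseq [:: x; y] w.
Proof.
move=> neq_xy; split=> [prec | /negP nsub b a wb wa].
  apply/negP=> /subseq2_onth[a [b [ltab wa wb]]].
  by have := prec b a wb wa; lia.
case: (ltngtP b a) => // [lt_ab | eq_ab].
  by case: nsub; apply/subseq2_onth; exists a, b.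
by move: wb neq_xy; rewrite eq_ab wa => -[->]; rewrite eqxx.
Qed.

Lemma subseq_map_inj {T U : eqType} {f : T -> U} (s w : seq T) :
  injective f -> subseq (map f s) (map f w) = subseq s w.
Proof.
move=> inj_f; elim: w s => [|c w IHw] [|a s] //=.
by rewrite (inj_eq inj_f) -IHw /=; case: eqP => // _; rewrite IHw.
Qed.

(** Words that are known to occur separately in [w] also occur one after the
    other as soon as every [y] of [w] precedes every [z]: this is how an edge
    combines with non-edges into a longer subsequence. *)
Lemma subseq_chain (T : eqType) (y z : T) (s t w : seq T) :
  y != z -> ~~ subseq [:: z; y] w ->
  subseq (rcons s y) w -> subseq (z :: t) w ->
  subseq (rcons s y ++ z :: t) w.
Proof.
move=> neq_yz; elim: w s => [|c w IHw] s; first by case: s.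
case: (eqVneq z c) => [<- | neq_zc].
  rewrite [subseq [:: z; y] _]/= eqxx sub1seq => yNw /mem_subseq/(_ y).
  by rewrite mem_rcons !inE eqxx (negPf neq_yz) (negPf yNw) => /(_ isT).
rewrite /= (negPf neq_zc).
case: s => [|a s] nsub /=; case: eqP => _ // sub_s sub_t.
- exact: (IHw [::]).
- exact: IHw.
- exact: (IHw (a :: s)).
Qed.

(** * The pattern 132 *)

Definition free132 (w : seq nat) : Prop :=
  forall x y z, x < y -> y < z -> ~~ subseq [:: x; z; y] w.

Lemma red_ltn (s : seq nat) (a b : nat) :
  let r c := index c (sort leq (undup s)) in
  a \in s -> b \in s -> r a < r b -> a < b.
Proof.
move=> r sa sb lt_ab.
have neq_ab : a != b by apply: contraTneq lt_ab => ->; rewrite ltnn.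
rewrite ltn_neqAle neq_ab.
by apply: (sorted_ltn_index leq_trans (sort_sorted leq_total (undup s)));
  rewrite ?mem_sort ?mem_undup.
Qed.

Lemma red_132P (s : seq nat) :
  red s = [:: 1; 3; 2] <-> exists x y z, [/\ s = [:: x; z; y], x < y & y < z].
Proof.
split=> [red_s | [x [y [z [-> ltxy ltyz]]]]].
  have : size s = 3 by have := congr1 size red_s; rewrite size_map.
  move: red_s; rewrite /red; have := @red_ltn s; set L := sort _ _.
  case: s @L => [|x [|z [|y []]]] // L; move: L => L /= lt_of_index.
  case=> rx rz ry _; exists x, y, z.
  by split=> //; apply: lt_of_index; rewrite ?inE ?eqxx ?orbT //= ?rx ?ry ?rz.
have sortE : sort leq (undup [:: x; z; y]) = [:: x; y; z].
  apply: (sorted_eq leq_trans anti_leq).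
  - exact: (sort_sorted leq_total).
  - by rewrite /= (ltnW ltxy) (ltnW ltyz).
  - rewrite perm_sort undup_id; last by rewrite /= !inE; lia.
    by rewrite perm_cons; apply: (permEl (perm_catC [:: z] [:: y])).
by rewrite /red sortE /= !eqxx; do ?[case: eqP => [?|_] /=; first lia].
Qed.

Lemma avoids132P (n : nat) (w : seq 'I_n) :
  avoids [:: 1; 3; 2] (word_of w) <-> free132 (map val w).
Proof.
rewrite /word_of (map_comp succn val); split=> [av x y z ltxy ltyz | free].
  apply/negP=> sub; apply: av; exists (map succn [:: x; z; y]).
    exact: map_subseq.
  by apply/red_132P; exists x.+1, y.+1, z.+1.
case=> s /subseqP[k _ ->]; rewrite -map_mask.
set s' := mask k _ => /red_132P[x [y [z [def_s ltxy ltyz]]]].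
have : subseq s' (map val w) by exact: mask_subseq.
case: s' def_s => [|a [|c [|b []]]] //= [def_x def_z def_y].
by apply/negP/free; lia.
Qed.

(** * Words from thresholds *)

(** The letters of [v] lying above some [a] of [u] have to be weakly increasing;
    this is granted by having no letter of [v] above a letter of [u]. *)
Lemma free132_cat (u v : seq nat) :
  {in u & v, forall a b, b <= a} -> free132 u -> free132 v -> free132 (u ++ v).
Proof.
move=> le_vu free_u free_v x y z ltxy ltyz; apply/negP.
have uvF a b : a < b -> a \in u -> b \in v -> False.
  by move=> ltab ua vb; have := le_vu a b ua vb; lia.
case/subseq_cat_split=> [[|x' [|z' [|y' [|? ?]]]]] [s2 [] //=].
- by move=> <- _ sub; case/negP: (free_v x y z ltxy ltyz).
- case=> <- <-; rewrite sub1seq => ux /mem_subseq/(_ y).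
  by rewrite !inE eqxx orbT => /(_ isT); apply: uvF ux.
- case=> <- _ <- /mem_subseq/(_ x); rewrite inE eqxx sub1seq => /(_ isT) ux.
  exact: uvF ux.
- by case=> <- <- <- _ sub; case/negP: (free_u x y z ltxy ltyz).
Qed.

Lemma free132_rcons_max (u : seq nat) (m : nat) :
  {in u, forall a, a <= m} -> free132 u -> free132 (rcons u m).
Proof.
move=> le_m free_u x y z ltxy ltyz; apply/negP; rewrite -cats1.
case/subseq_cat_split=> s1 [s2 [def_s sub1 sub2]].
move: (size_subseq sub2); case: s1 def_s sub1 => [|x' [|z' [|y' [|? ?]]]] /=.
- by move=> <-.
- by case=> _ <-.
- case=> _ <- def_s2 /mem_subseq/(_ z); rewrite -def_s2 !inE eqxx orbT in sub2 *.
  by move=> /(_ isT)/le_m; move: sub2; rewrite sub1seq inE => /eqP; lia.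
- by case=> <- <- <- _ sub; case/negP: (free_u x y z ltxy ltyz).
- by [].
Qed.

(** The word for the interval from [a] to [m] is [A ++ m :: B], where [A] is the
    word for the interval from [d] to [m - 1] and [B] the one for the interval
    from [a] to [d].  The letter [d] is shared: it has to precede [m], but may
    also have to follow some letters below it. *)
Lemma threshold_word (D : nat -> nat) (a b : nat) :
  (forall z w, z < w -> (D w <= D z) || (z <= D w)) ->
  exists w : seq nat,
    [/\ forall x, (x \in w) = (a <= x < b), free132 w &
        forall x y, a <= x -> x < y -> y < b ->
          subseq [:: x; y] w = (D y <= x)].
Proof.
move=> nestD; have [k] := ubnP (b - a).
elim: k a b => // k IHk a b ltk.
have [le_ba | lt_ab] := leqP b a.
  by exists [::]; split=> // [x | x y]; [rewrite in_nil|]; lia.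
case: b lt_ab ltk => // m le_am ltk.
pose d := maxn a (minn (D m) m).
have [|A [memA freeA subA]] := IHk d m; first by lia.
(* The minimum with [m] only matters when [m] precedes all other letters. *)
have [|B [memB freeB subB]] := IHk a (minn d.+1 m); first by lia.
have notsub (w : seq nat) x y :
    (x \in w) && (y \in w) = false -> subseq [:: x; y] w = false.
  apply: contraFF => /mem_subseq sub.
  by rewrite !sub ?inE ?eqxx ?orbT.
exists (rcons A m ++ B); split.
- by move=> x; rewrite mem_cat mem_rcons inE memA memB; lia.
- apply: free132_cat => //.
    by move=> x y; rewrite mem_rcons inE memA memB; lia.
  by apply: free132_rcons_max => // x; rewrite memA; lia.
- move=> x y le_ax ltxy lt_ym.
  rewrite cat_rcons subseq2_cat inE memA memB /=.
  have -> : (x == m) = false by lia.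
  have [eq_ym | neq_ym] := eqVneq y m.
    rewrite eq_ym in ltxy *; rewrite !notsub ?memA ?memB; lia.
  have [le_dx | lt_xd] := leqP d x.
    rewrite subA ?[subseq _ B]notsub ?memB; lia.
  rewrite [subseq _ A]notsub ?memA; last by lia.
  have [le_yd | lt_dy] := leqP y d.
    rewrite subB; lia.
  (* Here [d = D m < y < m], so that [D m <= D y]. *)
  have := nestD y m; rewrite notsub ?memB; lia.
Qed.

(** * Thresholds of a graph *)

(** Junk value [0] beyond [n]; it keeps the nesting condition valid there. *)
Definition threshold {n : nat} (e : rel 'I_n) (k : nat) : nat :=
  if (insub k : option 'I_n) is Some j
  then \max_(i < n | (i < j) && e i j) i.+1 else 0.

Lemma thresholdP {n : nat} {e : rel 'I_n} (i j : 'I_n) :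
  ~ (exists x y z : 'I_n, [/\ x < y, y < z, e y z & ~~ e x z]) ->
  i < j -> e i j = (i < threshold e j).
Proof.
move=> noa ltij; rewrite /threshold valK; apply/idP/idP => [eij | ].
  by apply: (@leq_bigmax_cond _ _ (fun i : 'I_n => i.+1) i); rewrite ltij.
apply: contraTT => Neij; rewrite -leqNgt; apply/bigmax_leqP=> y /andP[ltyj eyj].
rewrite ltnNge leq_eqVlt; apply/negP=> /predU1P[/val_inj eq_iy | ltiy].
  by rewrite eq_iy eyj in Neij.
by apply: noa; exists i, y, j.
Qed.

Lemma threshold_nested {n : nat} {e : rel 'I_n} (z w : nat) :
  ~ (exists x y z : 'I_n, [/\ x < y, y < z, e y z & ~~ e x z]) ->
  ~ (exists x y z w : 'I_n,
       [/\ x < y, y < z, z < w, e x w & ~~ e x z /\ ~~ e y w]) ->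
  z < w -> (threshold e w <= threshold e z) || (z <= threshold e w).
Proof.
move=> noa nob ltzw.
have [lt_wn | le_nw] := ltnP w n; last first.
  by rewrite {1}/threshold insubF //; lia.
have lt_zn : z < n by lia.
apply/norP=> -[]; rewrite -!ltnNge => lt_zw lt_wz.
have lt_yn : threshold e w < n by lia.
have lt_xn : threshold e z < n by lia.
apply: nob; exists (Ordinal lt_xn), (Ordinal lt_yn).
exists (Ordinal lt_zn), (Ordinal lt_wn).
split=> //; first by rewrite thresholdP //=; lia.
by rewrite !thresholdP //= ?ltnn //; lia.
Qed.

(** * The characterization *)

Lemma represents12E {n : nat} {w : seq 'I_n} {e : rel 'I_n} (i j : 'I_n) :
  represents12 w e -> i < j -> e i j = ~~ subseq [:: i; j] w.
Proof.
case=> _ rep ltij; have neq_ij : i != j by rewrite neq_ltn ltij.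
apply/idP/idP => [/(rep i j ltij)/all_precedeE | nsub]; first exact.
by apply/(rep i j ltij)/all_precedeE.
Qed.

Theorem theorem36 (n : nat) (e : rel 'I_n)
    (e_sym : symmetric e) (e_irr : irreflexive e) :
  representable12_avoiding [:: 1; 3; 2] e <->
  ~ (exists x y z : 'I_n, [/\ x < y, y < z, e y z & ~~ e x z]) /\
  ~ (exists x y z w : 'I_n,
       [/\ x < y, y < z, z < w, e x w & ~~ e x z /\ ~~ e y w]).
Proof.
split=> [[w /avoids132P free rep] | [noa nob]].
  have eE := fun i j => represents12E i j rep.
  have no132 (x y z : 'I_n) : x < y -> y < z -> ~~ subseq [:: x; z; y] w.
    by move=> ltxy ltyz; apply: contra (free x y z ltxy ltyz); apply: map_subseq.
  split=> [[x [y [z [ltxy ltyz]]]] | [x [y [z [t [ltxy ltyz ltzt]]]]]].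
    rewrite !eE ?negbK //; last by lia.
    move=> nsub sub; case/negP: (no132 x y z ltxy ltyz).
    apply: (@subseq_chain _ z y [:: x] [::]) => //.
      by rewrite neq_ltn ltyz orbT.
    by rewrite sub1seq; case: rep.
  rewrite !eE ?negbK; try lia.
  move=> nsub [sub_xz sub_yt]; case/negP: (no132 y z t ltyz ltzt).
  apply: (@subseq_trans _ [:: y; t; x; z]).
    by rewrite /= !eqxx; case: eqP => _ /=; rewrite ?eqxx.
  apply: (@subseq_chain _ t x [:: y] [:: z]) => //.
  by rewrite neq_ltn (ltn_trans ltxy (ltn_trans ltyz ltzt)) orbT.
have [w [memw freew subw]] :=
  threshold_word (threshold e) 0 n (fun z w => threshold_nested z w noa nob).
have valw : map val (pmap insub w : seq 'I_n) = w.
  rewrite pmap_filter; last exact: insubK.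
  by apply/all_filterP/allP=> x; rewrite memw isSome_insub.
exists (pmap insub w : seq 'I_n); first by apply/avoids132P; rewrite valw.
split=> [i | i j ltij]; first by rewrite -(mem_map val_inj) valw memw ltn_ord.
rewrite thresholdP // all_precedeE; last by rewrite neq_ltn ltij.
have -> : subseq [:: i; j] (pmap insub w) = subseq [:: val i; val j] w.
  by rewrite -[in RHS]valw -(subseq_map_inj _ _ val_inj).
by rewrite subw ?(ltn_ord j) // ltnNge.
Qed.
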